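(* Let $\Omega_j\in\mathbb{R}$, not all zero, with $\sum_{j=1}^N\Omega_j=0$, and set $\varepsilon=\frac1\kappa$. For $\varepsilon>0$ small enough (so that at least $\kappa>\kappa^*$, the critical coupling value defined in the context), the fixed point $$z_{jk}=e^{i(\alpha_j-\alpha_k)}$$ of the correlation system $$\frac{d}{dt}z_{jk}=i(\Omega_j-\Omega_k)z_{jk}+\frac{\kappa}{2N}\sum_{l=1}^N(z_{jl}+z_{lk})(1-z_{jk}),\qquad j,k=1,\dots,N,$$ is linearly stable, where $\alpha_j\in(-\frac\pi2,\frac\pi2)$ satisfy, for each $j=1,\dots,N$, $$\alpha_j=\sin^{-1}\Big(\frac{\Omega_j}{\lambda\kappa}\Big),\qquad \cos(\alpha_j)=\sqrt{1-\Big(\frac{\Omega_j}{\lambda\kappa}\Big)^2}\ge0,\qquad \lambda=\frac1N\sum_{l=1}^N\cos(\alpha_l).$$ Moreover, under the extra assumption that $\Omega_{j_1}-\Omega_{k_1}\ne\Omega_{j_2}-\Omega_{k_2}$ for any two distinct pairs $(j_1,k_1)\neq(j_2,k_2)$ with $j_1\ne k_1$, $j_2\neq k_2$, the fixed point is linearly stable for all $\kappa\ge2\sqrt2\max_j|\Omega_j|$.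
   Context: $N\ge2$, $\kappa>0$, $z_{jj}=1$. The phase-locked states considered are those on the stable branch: for $\kappa\geq\kappa^*$ the branch along which $\lambda$ is increasing in $\kappa$, with $\lambda\to1$ and $\alpha_j\to0$ as $\kappa\to\infty$; they also satisfy $\frac1N\sum_l\sin\alpha_l=0$. $\kappa^*$ is the critical coupling at which this branch of phase-locked states with $\cos\alpha_j>0$ begins, characterized by $\lambda=\frac1N\sum_j\cos\alpha_j=\frac1{2N}\sum_j\frac1{\cos\alpha_j}$ (together with $\Omega_j=\lambda\kappa^*\sin\alpha_j$). Linear stability: with the $N(N-1)$ independent complex variables $\mathbf z=(z_{jk})_{j\ne k}$ (and $z_{jj}=1$), define the holomorphic map $$F_{jk}(\mathbf z)=-\frac{i(\Omega_j-\Omega_k)}{\kappa}z_{jk}-\frac1{2N}\sum_{l=1}^N(z_{jl}+z_{lk})(1-z_{jk}),\quad j\ne k.$$ A fixed point is linearly stable if all eigenvalues of the complex Jacobian $D_{\mathbf z}F$ at it have positive real part. *)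

(* Defs.v *)
From mathcomp Require Import all_boot all_order all_algebra.
From mathcomp Require Import all_classical all_reals all_analysis.
From mathcomp Require Import complex.

Set Implicit Arguments.
Unset Strict Implicit.
Unset Printing Implicit Defensive.

Import Order.TTheory GRing.Theory Num.Theory.
Import numFieldNormedType.Exports.

Local Open Scope classical_set_scope.
Local Open Scope complex_scope.
Local Open Scope ring_scope.

Section CorrelationSystem.
Variables (R : realType) (N : nat).
Implicit Types (Omega alpha : 'I_N -> R) (kappa lambda : R) (Z : 'M[R[i]]_N).

(* Right-hand side of dz_jk/dt, for all pairs (j, k). *)
Definition correlation_field Omega kappa Z : 'M[R[i]]_N :=
  \matrix_(j, k) ('i%C * (Omega j - Omega k)%:C * Z j k
    + (kappa / (2 * N%:R))%:C * (\sum_(l < N) (Z j l + Z l k)) * (1 - Z j k)).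

Definition fixed_point Omega kappa Z : Prop :=
  correlation_field Omega kappa Z = 0.

(* The independent variables z_jk, j != k, form a row vector whose entries are
   numbered by enum_rank. *)
Notation offdiag := {p : 'I_N * 'I_N | p.1 != p.2}.

Definition with_unit_diag (z : 'rV[R[i]]_#|{: offdiag}|) : 'M[R[i]]_N :=
  \matrix_(j, k)
    if insub (j, k) is Some p then z 0 (enum_rank (p : offdiag)) else 1.

Definition offdiag_part Z : 'rV[R[i]]_#|{: offdiag}| :=
  \row_a Z (val (enum_val a)).1 (val (enum_val a)).2.

(* The reduced map is -1/kappa times the correlation field, whence stability
   corresponds to positive real parts below. *)
Definition reduced_map Omega kappa (z : 'rV[R[i]]_#|{: offdiag}|) :
    'rV[R[i]]_#|{: offdiag}| :=
  let Z := with_unit_diag z in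
  offdiag_part (\matrix_(j, k)
    (- ('i%C * (Omega j - Omega k)%:C / kappa%:C) * Z j k
     - (2 * N%:R)^-1 * (\sum_(l < N) (Z j l + Z l k)) * (1 - Z j k))).

(* 'J is the derivative over the field R[i], i.e. the complex Jacobian; it acts
   on row vectors from the right, so its eigenvalues, in the (left) sense of
   [eigenvalue], are those of the linearization. *)
Definition linearly_stable Omega kappa Z : Prop :=
  [/\ fixed_point Omega kappa Z, (forall j, Z j j = 1) &
      forall mu : R[i],
        eigenvalue ('J (reduced_map Omega kappa) (offdiag_part Z)) mu ->
        0 < complex.Re mu].

Definition phase_point alpha : 'M[R[i]]_N :=
  \matrix_(j, k) (cos (alpha j - alpha k) +i* sin (alpha j - alpha k)).

Definition phase_locked Omega kappa lambda alpha : Prop :=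
  [/\ forall j, - (pi / 2) < alpha j < pi / 2,
      forall j, alpha j = asin (Omega j / (lambda * kappa)),
      forall j, cos (alpha j) = Num.sqrt (1 - (Omega j / (lambda * kappa)) ^+ 2) &
      lambda = N%:R^-1 * \sum_(l < N) cos (alpha l)].

Definition critical_state Omega kappa lambda alpha : Prop :=
  phase_locked Omega kappa lambda alpha /\
  lambda = (2 * N%:R)^-1 * \sum_(l < N) (cos (alpha l))^-1.

(* lambda and alpha are functions of kappa, only relevant on [kstar, +oo[. *)
Definition stable_branch Omega (kstar : R) (lambda : R -> R)
    (alpha : R -> 'I_N -> R) : Prop :=
  [/\ 0 < kstar /\ critical_state Omega kstar (lambda kstar) (alpha kstar),
      forall kappa, kstar <= kappa ->
        phase_locked Omega kappa (lambda kappa) (alpha kappa),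
      forall k1 k2, kstar <= k1 -> k1 < k2 -> lambda k1 < lambda k2,
      lambda kappa @[kappa --> +oo] --> (1 : R) &
      forall j, alpha kappa j @[kappa --> +oo] --> (0 : R)].

End CorrelationSystem.

(* Main.v *)
From HB Require Import structures.
Require Import Defs.
From mathcomp Require Import all_boot all_order all_algebra.
From mathcomp Require Import all_classical all_reals all_analysis.
From mathcomp Require Import complex.
From mathcomp Require Import ring lra.

(* Write [e_j] for [exp (i alpha_j)]. At the fixed point the linearization sends
   [w] to [d_jk w_jk - (1 - z_jk) / (2N) * sum_l (w_jl + w_lk)], where
   [d_jk = lambda / 2 * (e_j^* + e_k)]. Gershgorin's theorem in the unknowns
   [w_jk / (1 - z_jk)] puts every eigenvalue in a disc with centre [d_jk] and
   radius [(m_j + m_k) / 2], where [m_j] is the mean over [l] of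
   [|e_j - e_l|]; the mean of [|e_j - e_l| ^ 2] is
   [2 - 2 lambda cos alpha_j], so these discs lie in the right half-plane as
   soon as [lambda cos alpha_j >= 3 / 4] for all [j]. At the critical coupling
   [lambda >= 1 / sqrt 2], and this persists along the branch since [lambda]
   increases; so [|sin alpha_j| <= 1 / 2], whence [cos alpha_j] and [lambda] are
   at least [sqrt 3 / 2], once [kappa >= 2 sqrt 2 max |Omega_j|]. Some
   [|sin alpha_j|] is at least [1 / sqrt 2] at the critical coupling, which is
   therefore at most [2 max |Omega_j|]. *)

Set Implicit Arguments.
Unset Strict Implicit.
Unset Printing Implicit Defensive.

Import Order.TTheory GRing.Theory Num.Theory.
Import numFieldNormedType.Exports.

Local Open Scope ring_scope.

(** * Sup norm of matrices and differentials of maps with quadratic remainder *)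

Section MatrixNorm.
Variables (K : numFieldType) (m n : nat).

Lemma norm_entry_le (M : 'M[K]_(m, n)) i j : `|M i j| <= `|M|.
Proof.
rewrite [leRHS]/(Num.norm _) /= mx_normE -[leLHS]nngE num_le.
exact: (le_bigmax _ (fun p : 'I_m * 'I_n => `|M p.1 p.2|%:nng) (i, j)).
Qed.

Lemma norm_mx_le (M : 'M[K]_(m, n)) (e : K) :
  0 <= e -> (forall i j, `|M i j| <= e) -> `|M| <= e.
Proof.
move=> /nonnegP[{}e] Me; rewrite [leLHS]/(Num.norm _) /= mx_normE num_le.
by apply/bigmax_leP; split=> [|[i j] _]; [rewrite -num_le /=|exact: Me].
Qed.

End MatrixNorm.

(** Expanding [u] in the standard basis bounds [f u] by [|u|] times the sum of the norms of the
    images of the basis vectors. *)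
Lemma linear_rV_continuous (K : numFieldType) (n : nat) (W : normedModType K)
  (f : {linear 'rV[K]_n -> W}) : continuous f.
Proof.
apply/linear_bounded_continuous/linear_boundedP.
exists (\sum_(j < n) `|f (delta_mx 0 j)|).
split=> [|r hr]; first by apply: ger0_real; apply: sumr_ge0.
move=> u; rewrite {1}[u]row_sum_delta linear_sum.
apply: le_trans (ler_norm_sum _ _ _) _.
apply: (@le_trans _ _ ((\sum_(j < n) `|f (delta_mx 0 j)|) * `|u|)).
  rewrite mulr_suml ler_sum // => j _.
  by rewrite linearZ normrZ mulrC ler_wpM2l // norm_entry_le.
by rewrite ler_wpM2r // ltW.
Qed.

Lemma diff_quadratic_remainder (K : numFieldType) (n : nat)
  (W : normedModType K) (f : 'rV[K]_n -> W) (df : {linear 'rV[K]_n -> W})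
  (q : 'rV[K]_n -> W) (x : 'rV[K]_n) :
  (forall h, f (x + h) = f x + df h + q h) ->
  (forall h, `|q h| <= `|h| ^+ 2) ->
  'd f x = df :> ('rV[K]_n -> W).
Proof.
move=> fE qle; apply: diff_unique; first exact: linear_rV_continuous.
apply/eqaddoP => _ /posnumP[e]; near=> h.
rewrite /= -[X in `|X|]/(f (h + x) - (f x + df h)) addrC [h + x]addrC fE.
rewrite addKr (le_trans (qle h)) // expr2.
(* As soon as [|h| <= e], the remainder is at most [e * |h|]. *)
by apply: ler_wpM2r => //; near: h; apply: nbhs0_le.
Unshelve. all: end_near. Qed.

(** * The complex Jacobian of the reduced map *)

Section Linearization.
Variables (R : realType) (N : nat) (Omega : 'I_N -> R) (kappa : R).
Notation offdiag := {p : 'I_N * 'I_N | p.1 != p.2}.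
Notation vec := 'rV[R[i]]_#|{: offdiag}|.
Implicit Types (Z : 'M[R[i]]_N) (z h u : vec).

(** Tangent counterpart of [with_unit_diag]: perturbations keep [z_jj = 1], so their diagonal
    vanishes. *)
Definition with_zero_diag h : 'M[R[i]]_N :=
  \matrix_(j, k)
    if insub (j, k) is Some p then h 0 (enum_rank (p : offdiag)) else 0.

Lemma with_zero_diag_diag h j : with_zero_diag h j j = 0.
Proof. by rewrite mxE insubF //= eqxx. Qed.

Lemma with_zero_diag_is_linear : linear with_zero_diag.
Proof.
move=> a u h; apply/matrixP => j k; rewrite !mxE.
by case: insub => [p|]; rewrite ?mxE // mulr0 addr0.
Qed.

HB.instance Definition _ := GRing.isLinear.Build R[i] vec 'M[R[i]]_N _
  with_zero_diag with_zero_diag_is_linear.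

Lemma with_zero_diagK : cancel with_zero_diag (@offdiag_part R N).
Proof.
move=> h; apply/rowP => a; rewrite !mxE.
by rewrite -surjective_pairing valK enum_valK.
Qed.

Lemma with_zero_diag_offdiag_part Z j k :
  j != k -> with_zero_diag (offdiag_part Z) j k = Z j k.
Proof.
move=> jk; rewrite mxE; case: insubP => [p _ pE|]; last by rewrite jk.
by rewrite mxE enum_rankK pE.
Qed.

Lemma with_unit_diagK Z :
  (forall j, Z j j = 1) -> with_unit_diag (offdiag_part Z) = Z.
Proof.
move=> Z1; apply/matrixP => j k; rewrite mxE.
case: insubP => [p _ pE|]; first by rewrite mxE enum_rankK pE.
by rewrite /= negbK => /eqP ->; rewrite Z1.
Qed.

Lemma with_unit_diagD z h :
  with_unit_diag (z + h) = with_unit_diag z + with_zero_diag h.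
Proof.
apply/matrixP => j k; rewrite !mxE.
by case: insub => [p|]; rewrite ?mxE // addr0.
Qed.

Lemma with_zero_diag_le h j k : `|with_zero_diag h j k| <= `|h|.
Proof.
rewrite mxE; case: insub => [p|]; last by rewrite normr0.
exact: norm_entry_le.
Qed.

(** The terms in [H j k] are collected, so that their coefficient becomes the Gershgorin centre at
    the fixed point. *)
Definition linearization Z h : vec :=
  let H := with_zero_diag h in
  offdiag_part (\matrix_(j, k)
    ((- ('i%C * (Omega j - Omega k)%:C%C / kappa%:C%C)
       + (2 * N%:R)^-1 * \sum_(l < N) (Z j l + Z l k)) * H j k
     - (2 * N%:R)^-1 * (\sum_(l < N) (H j l + H l k)) * (1 - Z j k))).

Lemma linearizationE Z h i :
  let H := with_zero_diag h in
  let j := (val (enum_val i)).1 in let k := (val (enum_val i)).2 in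
  linearization Z h 0 i =
    (- ('i%C * (Omega j - Omega k)%:C%C / kappa%:C%C)
       + (2 * N%:R)^-1 * \sum_(l < N) (Z j l + Z l k)) * H j k
     - (2 * N%:R)^-1 * (\sum_(l < N) (H j l + H l k)) * (1 - Z j k).
Proof. by rewrite /= [LHS]mxE [LHS]mxE. Qed.

Lemma linearization_is_linear Z : linear (linearization Z).
Proof.
move=> a u h; apply/rowP => i.
rewrite [RHS]mxE [(a *: linearization Z u) _ _]mxE !linearizationE.
set j := (val _).1; set k := (val _).2.
rewrite linearP /=.
set U := with_zero_diag u; set V := with_zero_diag h.
have -> : \sum_(l < N) ((a *: U + V) j l + (a *: U + V) l k) =
    a * \sum_(l < N) (U j l + U l k) + \sum_(l < N) (V j l + V l k).
  by rewrite mulr_sumr -big_split; apply: eq_bigr => l _; rewrite !mxE /=; ring.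
by rewrite ![(a *: U + V) _ _]mxE ![(a *: U) _ _]mxE; ring.
Qed.

HB.instance Definition _ Z := GRing.isLinear.Build R[i] vec vec _
  (linearization Z) (linearization_is_linear Z).

(** The reduced map is a polynomial of degree two, so its expansion stops exactly at this term. *)
Definition quadratic_part h : vec :=
  let H := with_zero_diag h in
  offdiag_part (\matrix_(j, k)
    ((2 * N%:R)^-1 * (\sum_(l < N) (H j l + H l k)) * H j k)).

Lemma quadratic_partE h i :
  let H := with_zero_diag h in
  let j := (val (enum_val i)).1 in let k := (val (enum_val i)).2 in
  quadratic_part h 0 i =
    (2 * N%:R)^-1 * (\sum_(l < N) (H j l + H l k)) * H j k.
Proof. by rewrite /= [LHS]mxE [LHS]mxE. Qed.

Lemma quadratic_part_le h : `|quadratic_part h| <= `|h| ^+ 2.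
Proof.
apply: norm_mx_le => [|i a]; first exact: exprn_ge0.
rewrite !ord1 quadratic_partE.
set j := (val _).1; set k := (val _).2.
rewrite normrM expr2 ler_pM ?with_zero_diag_le //.
have N0 : (0 : R[i]) < 2 * N%:R.
  by rewrite mulr_gt0 ?ltr0n //; case: (N) j => [[]|].
rewrite normrM normfV (gtr0_norm N0) [leLHS]mulrC ler_pdivrMr //.
apply: le_trans (ler_norm_sum _ _ _) _.
apply: (@le_trans _ _ (\sum_(l < N) (`|h| *+ 2))).
  apply: ler_sum => l _; rewrite mulr2n.
  by rewrite (le_trans (ler_normD _ _)) // lerD ?with_zero_diag_le.
by rewrite sumr_const card_ord -mulrnA -natrM mulr_natr.
Qed.

Lemma reduced_mapE z i :
  let Z := with_unit_diag z in
  let j := (val (enum_val i)).1 in let k := (val (enum_val i)).2 in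
  reduced_map Omega kappa z 0 i =
    - ('i%C * (Omega j - Omega k)%:C%C / kappa%:C%C) * Z j k
     - (2 * N%:R)^-1 * (\sum_(l < N) (Z j l + Z l k)) * (1 - Z j k).
Proof. by rewrite /= [LHS]mxE [LHS]mxE. Qed.

Lemma reduced_mapD z h :
  reduced_map Omega kappa (z + h) =
  reduced_map Omega kappa z + linearization (with_unit_diag z) h
    + quadratic_part h.
Proof.
apply/rowP => i.
rewrite [RHS]mxE [(reduced_map _ _ _ + _) _ _]mxE linearizationE.
rewrite !reduced_mapE quadratic_partE with_unit_diagD.
set j := (val _).1; set k := (val _).2.
set Z := with_unit_diag z; set H := with_zero_diag h.
have -> : \sum_(l < N) ((Z + H) j l + (Z + H) l k) =
    \sum_(l < N) (Z j l + Z l k) + \sum_(l < N) (H j l + H l k).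
  by rewrite -big_split; apply: eq_bigr => l _; rewrite !mxE /=; ring.
by rewrite ![(Z + H) _ _]mxE; ring.
Qed.

Lemma mul_jacobian_reduced_map z u :
  u *m 'J (reduced_map Omega kappa) z = linearization (with_unit_diag z) u.
Proof.
rewrite mul_rV_lin1 (diff_quadratic_remainder (reduced_mapD z)) //.
exact: quadratic_part_le.
Qed.

End Linearization.

(* Gershgorin's theorem for the unknowns [w j k / (1 - z j k)]: the rescaling
   turns the factor [1 - z j k] of row [(j, k)] into the weights under the sum,
   so that it gets averaged. *)
Lemma rescaled_gershgorin (R : realType) (N : nat) (d z w : 'M[R[i]]_N)
  (mu : R[i]) :
  w != 0 -> (forall j, w j j = 0) ->
  (forall j k, j != k ->
     d j k * w j k - (2 * N%:R)^-1 * (\sum_(l < N) (w j l + w l k))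
                       * (1 - z j k) = mu * w j k) ->
  exists j k, `|d j k - mu| <=
    (2 * N%:R)^-1 * \sum_(l < N) (`|1 - z j l| + `|1 - z l k|).
Proof.
move=> w0 wdiag eqw.
have [j0 [k0 wjk0]] : exists j k, w j k != 0.
  apply: contra_neqP w0 => W; apply/matrixP => j k; rewrite mxE.
  by apply: contra_notP W => /eqP; exists j, k.
have rhs_ge0 j k :
    0 <= (2 * N%:R)^-1 * \sum_(l < N) (`|1 - z j l| + `|1 - z l k|).
  rewrite mulr_ge0 ?invr_ge0 ?mulr_ge0 ?ler0n //.
  by apply: sumr_ge0 => l _; rewrite addr_ge0.
(* If [z j k = 1] at a nonzero entry of [w], its equation reads [d j k = mu], so [mu] is the centre
   of a disc. *)
have [[j [k [wjk /eqP zjk]]]|z1] :=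
    pselect (exists j k, w j k != 0 /\ 1 - z j k == 0).
  exists j, k; suff -> : d j k = mu by rewrite subrr normr0.
  apply: (mulIf wjk); rewrite -eqw; first by rewrite zjk mulr0 subr0.
  by apply: contra_neq wjk => ->; exact: wdiag.
(* From here on [w] vanishes wherever [1 - z] does, so the convention [x / 0 = 0] gives [v] a
   consistent value there. *)
pose v j k := w j k / (1 - z j k).
have wE j k : w j k = (1 - z j k) * v j k.
  have [w00|wn0] := eqVneq (w j k) 0; first by rewrite /v w00 mul0r mulr0.
  rewrite mulrC divfK //; apply/negP => zjk; apply: z1.
  by exists j, k.
(* Norms lie in [R[i]], which is only partially ordered, so their real parts are maximized. *)
have [[j k] /= _ vmax] := arg_maxP
  (fun p => complex.Re `|v p.1 p.2|) (erefl : predT (j0, k0)).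
have vle j' k' : `|v j' k'| <= `|v j k|.
  have := vmax (j', k') erefl.
  by rewrite /= -lecR.
have vjk : v j k != 0.
  rewrite -normr_gt0; apply: lt_le_trans (vle j0 k0).
  by rewrite normr_gt0; apply: contra_neq wjk0 => v0; rewrite wE v0 mulr0.
have jk : j != k by apply: contra_neq vjk => ->; rewrite /v wdiag mul0r.
have zjk : 1 - z j k != 0.
  by apply: contra_neq vjk => z0; rewrite /v z0 invr0 mulr0.
exists j, k.
rewrite -(ler_pM2r (x := `|v j k|)) ?normr_gt0 // -normrM.
have -> : (d j k - mu) * v j k =
    (2 * N%:R)^-1 * \sum_(l < N) (w j l + w l k).
  apply: (mulIf zjk); have := eqw _ _ jk; rewrite wE => h.
  have -> : (d j k - mu) * v j k * (1 - z j k) =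
    d j k * ((1 - z j k) * v j k) - mu * ((1 - z j k) * v j k) by ring.
  by rewrite -h; ring.
rewrite normrM ger0_norm ?invr_ge0 ?mulr_ge0 ?ler0n // -mulrA.
rewrite ler_wpM2l ?invr_ge0 ?mulr_ge0 ?ler0n //.
rewrite mulr_suml (le_trans (ler_norm_sum _ _ _)) // ler_sum // => l _.
rewrite (le_trans (ler_normD _ _)) // [leRHS]mulrDl.
by rewrite (wE j l) (wE l k) lerD // normrM ler_wpM2l.
Qed.

Lemma ord_natr_neq0 (K : numDomainType) (n : nat) (i : 'I_n) :
  n%:R != 0 :> K.
Proof. by rewrite pnatr_eq0 -lt0n (leq_ltn_trans _ (ltn_ord i)). Qed.

(** * Stability of a phase point with real order parameter *)

Section PhasePoint.
Variables (R : realType) (N : nat).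

Definition cis (t : R) : R[i] := (cos t +i* sin t)%C.

Lemma cis_conj t : cis t * (cis t)^*%C = 1.
Proof.
apply/eqP; rewrite eq_complex /=; apply/andP; split; apply/eqP.
  by rewrite mulrN opprK -!expr2 cos2Dsin2.
by ring.
Qed.

Lemma sin_cis t : 'i%C * (sin t)%:C%C = (cis t - (cis t)^*%C) / 2.
Proof.
apply: (mulIf (_ : 2 != 0 :> R[i])); first by rewrite pnatr_eq0.
rewrite divfK ?pnatr_eq0 // mulr_natr.
by apply/eqP; rewrite eq_complex /=; apply/andP; split; apply/eqP; ring.
Qed.

Variables (Omega alpha : 'I_N -> R) (kappa lambda : R).
Let Z := phase_point alpha.
Let e j := cis (alpha j).

Lemma phase_pointE j k : Z j k = e j * (e k)^*%C.
Proof.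
rewrite mxE cosB sinB; apply/eqP; rewrite eq_complex /=.
by apply/andP; split; apply/eqP; ring.
Qed.

Lemma phase_point_diag j : Z j j = 1.
Proof. by rewrite phase_pointE cis_conj. Qed.

Hypothesis kappa_gt0 : 0 < kappa.
Hypothesis OmegaE : forall j, Omega j = lambda * kappa * sin (alpha j).
Hypothesis sum_sin : \sum_(l < N) sin (alpha l) = 0.
Hypothesis sum_cos : \sum_(l < N) cos (alpha l) = N%:R * lambda.

(** The two hypotheses on sums say that the Kuramoto order parameter, the mean of the [e l], is the
    real number [lambda]. *)
Lemma sum_cis : \sum_(l < N) e l = (N%:R * lambda)%:C%C.
Proof.
apply/eqP; rewrite eq_complex /= !raddf_sum /=.
by apply/andP; split; apply/eqP.
Qed.

Lemma sum_phase_point j k :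
  \sum_(l < N) (Z j l + Z l k) = (N%:R * lambda)%:C%C * (e j + (e k)^*%C).
Proof.
under eq_bigr do rewrite !phase_pointE.
rewrite big_split /= -mulr_sumr -mulr_suml.
have -> : \sum_(l < N) (e l)^*%C = (\sum_(l < N) e l)^*%C by rewrite raddf_sum.
by rewrite sum_cis conjc_real mulrDr [e j * _]mulrC.
Qed.

Lemma Omega_cis j k : 'i%C * (Omega j - Omega k)%:C%C =
  (lambda * kappa)%:C%C * (e j - (e j)^*%C - e k + (e k)^*%C) / 2.
Proof.
rewrite !OmegaE -mulrBr rmorphM rmorphB mulrCA [X in _ * X]mulrBr !sin_cis.
by rewrite -/(e j) -/(e k); field.
Qed.

Lemma phase_point_fixed : fixed_point Omega kappa Z.
Proof.
apply/matrixP => j k; rewrite mxE sum_phase_point Omega_cis phase_pointE mxE.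
have N0 : (N%:R : R[i]) != 0 by exact: ord_natr_neq0 _ j.
rewrite fmorph_div !(rmorphM (real_complex R)) !rmorph_nat.
have := cis_conj (alpha j); have := cis_conj (alpha k).
rewrite -/(e j) -/(e k); move: (e j) (e k) => a b hb ha.
(* The field is a combination of [1 - a a^*] and [1 - b b^*], which vanish on the unit circle. *)
transitivity (lambda%:C%C * kappa%:C%C / 2 *
  (b^*%C * (1 - a * a^*%C) + a * (1 - b * b^*%C))); first by field.
by rewrite ha hb !subrr !mulr0 addr0 mulr0.
Qed.

(** The frequency term conjugates the coupling term [e j + (e k)^*]; the real part stays
    [lambda (cos alpha_j + cos alpha_k) / 2]. *)
Lemma linearization_diag j k :
  - ('i%C * (Omega j - Omega k)%:C%C / kappa%:C%C)
    + (2 * N%:R)^-1 * \sum_(l < N) (Z j l + Z l k) =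
  lambda%:C%C / 2 * ((e j)^*%C + e k).
Proof.
have N0 : (N%:R : R[i]) != 0 by exact: ord_natr_neq0 _ j.
have k0 : kappa%:C%C != 0 by rewrite fmorph_eq0 gt_eqF.
rewrite sum_phase_point Omega_cis !(rmorphM (real_complex R)) !rmorph_nat.
by field; rewrite N0 k0.
Qed.

(* [r <= 2 / 3 * r ^ 2 + 3 / 8] is [0 <= (r - 3 / 4) ^ 2]; the mean of the
   squares is known from [sum_cosB]. *)
Lemma norm_1Bphase_point_le j k :
  `|1 - Z j k| <= (2 / 3 * (2 - 2 * cos (alpha j - alpha k)) + 3 / 8)%:C%C.
Proof.
rewrite mxE normc_def lecR /=.
set c := cos _; set s := sin _.
have c1 : c <= 1 := cos_le1 _.
have -> : (1 - c) ^+ 2 + (0 - s) ^+ 2 = 1 + (c ^+ 2 + s ^+ 2) - 2 * c by ring.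
rewrite [c ^+ 2 + _]cos2Dsin2 -[1 + 1]/2.
have /sqr_sqrtr : 0 <= 2 - 2 * c by lra.
move: (Num.sqrt _) => r rE; have := sqr_ge0 (r - 3 / 4); rewrite -rE; lra.
Qed.

Lemma sum_cosB j :
  \sum_(l < N) cos (alpha j - alpha l) = N%:R * (lambda * cos (alpha j)).
Proof.
under eq_bigr do rewrite cosB.
by rewrite big_split /= -!mulr_sumr sum_sin sum_cos mulr0 addr0; ring.
Qed.

Lemma phase_point_linearly_stable :
  (forall j, 3 / 4 <= lambda * cos (alpha j)) -> linearly_stable Omega kappa Z.
Proof.
move=> lcos; split; [exact: phase_point_fixed|exact: phase_point_diag|].
move=> mu /eigenvalueP[u]; rewrite mul_jacobian_reduced_map.
rewrite with_unit_diagK; last exact: phase_point_diag.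
move=> uE u0.
have [|||j [k]] := @rescaled_gershgorin R N
  (\matrix_(j, k) (lambda%:C%C / 2 * ((e j)^*%C + e k))) Z
  (with_zero_diag u) mu.
- apply: contra_neq u0 => h; rewrite -[u]with_zero_diagK h.
  by apply/rowP => i; rewrite !mxE.
- exact: with_zero_diag_diag.
- move=> j k jk; have := congr1 (fun x => with_zero_diag x j k) uE.
  rewrite linearZ /= with_zero_diag_offdiag_part // [LHS]mxE linearization_diag.
  by rewrite [RHS]mxE => <-; rewrite [X in X * _]mxE.
rewrite mxE => dle.
have : complex.Re (lambda%:C%C / 2 * ((e j)^*%C + e k) - mu) <=
    (2 * N%:R)^-1 *
    \sum_(l < N) (2 / 3 * (2 - 2 * cos (alpha j - alpha l)) + 3 / 8
      + (2 / 3 * (2 - 2 * cos (alpha l - alpha k)) + 3 / 8)).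
  apply: le_trans (ler_norm _) _.
  rewrite -lecR (le_trans (normc_ge_Re _)) // (le_trans dle) //.
  rewrite rmorphM fmorphV !rmorphM !rmorph_nat raddf_sum.
  rewrite ler_wpM2l ?invr_ge0 ?mulr_ge0 ?ler0n //.
  apply: ler_sum => l _; rewrite -[leRHS]/(real_complex R (_ + _)) rmorphD.
  by rewrite lerD // norm_1Bphase_point_le.
have -> : complex.Re (lambda%:C%C / 2 * ((e j)^*%C + e k) - mu) =
    (lambda * cos (alpha j) + lambda * cos (alpha k)) / 2 - complex.Re mu.
  have -> : lambda%:C%C / 2 = (lambda / 2)%:C%C.
    by rewrite -[2 in LHS](rmorph_nat (real_complex R)) -fmorph_div.
  by case: mu {uE dle} => a b /=; ring.
have -> : \sum_(l < N) (2 / 3 * (2 - 2 * cos (alpha j - alpha l)) + 3 / 8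
      + (2 / 3 * (2 - 2 * cos (alpha l - alpha k)) + 3 / 8)) =
    N%:R * (41 / 12
      - 4 / 3 * (lambda * cos (alpha j) + lambda * cos (alpha k))).
  under eq_bigr => l _ do rewrite -[cos (alpha l - _)]cosN opprB.
  transitivity (\sum_(l < N) (41 / 12)
      - 4 / 3 * \sum_(l < N) cos (alpha j - alpha l)
      - 4 / 3 * \sum_(l < N) cos (alpha k - alpha l)).
    rewrite !mulr_sumr -!sumrB; by apply: eq_bigr => l _; field.
  by rewrite !sum_cosB sumr_const card_ord -[_ *+ N]mulr_natl; ring.
have N0 : (N%:R : R) != 0 by exact: ord_natr_neq0 _ j.
rewrite [(_ * _)^-1]invfM -[leRHS]mulrA [_^-1 * (N%:R * _)]mulKf //.
(* With [S = lambda (cos alpha_j + cos alpha_k)] the disc gives [Re mu >= 7/6 S - 41/24], which is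
   at least [1/24] because [S >= 3/2]. *)
have := lcos j; have := lcos k; lra.
Qed.
End PhasePoint.

(** * Phase-locked states *)

Section PhaseLocked.
Variables (R : realType) (N : nat) (Omega alpha : 'I_N -> R).
Variables (kappa lambda : R).
Hypothesis locked : phase_locked Omega kappa lambda alpha.

Lemma phase_locked_cos_gt0 j : 0 < cos (alpha j).
Proof. by case: locked => /(_ j) + _ _ _; exact: cos_gt0_pihalf. Qed.

Lemma phase_locked_sin j : sin (alpha j) = Omega j / (lambda * kappa).
Proof.
have cj := phase_locked_cos_gt0 j.
case: locked => _ /(_ j) -> /(_ j) cE _; rewrite asinK // in_itv /=.
(* The cosine is a positive square root, which forces the argument of [asin] into [[-1, 1]]. *)
by move: cj; rewrite cE sqrtr_gt0; nra.
Qed.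

Hypothesis N_gt0 : (0 < N)%N.

Lemma phase_locked_sum_cos : \sum_(l < N) cos (alpha l) = N%:R * lambda.
Proof.
by case: locked => _ _ _ ->; rewrite mulVKf // pnatr_eq0 -lt0n.
Qed.

Lemma phase_locked_lambda_gt0 : 0 < lambda.
Proof.
rewrite -(pmulr_rgt0 _ (_ : 0 < N%:R)) ?ltr0n // -phase_locked_sum_cos.
rewrite (bigD1 (Ordinal N_gt0)) //= ltr_wpDr ?phase_locked_cos_gt0 //.
by apply: sumr_ge0 => l _; exact/ltW/phase_locked_cos_gt0.
Qed.

(** Every cosine is at least [sqrt (3/4)], hence so is their mean [lambda], and the products
    [lambda cos alpha_j] reach [3/4]. *)
Lemma phase_locked_linearly_stable :
  0 < kappa -> \sum_(j < N) Omega j = 0 ->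
  (forall j, 3 / 4 <= cos (alpha j) ^+ 2) ->
  linearly_stable Omega kappa (phase_point alpha).
Proof.
move=> kappa0 Omega0 cos2; have lambda0 := phase_locked_lambda_gt0.
apply: (@phase_point_linearly_stable _ _ _ _ _ lambda) => //.
- by move=> j; rewrite phase_locked_sin mulrC divfK // mulf_neq0 ?gt_eqF.
- under eq_bigr do rewrite phase_locked_sin.
  by rewrite -mulr_suml Omega0 mul0r.
- exact: phase_locked_sum_cos.
pose s : R := Num.sqrt (3 / 4).
have s2 : s ^+ 2 = 3 / 4 by rewrite sqr_sqrtr.
have s_le j : s <= cos (alpha j).
  rewrite -[leRHS]ger0_norm ?(ltW (phase_locked_cos_gt0 _)) //.
  by rewrite -sqrtr_sqr ler_wsqrtr.
have sl : s <= lambda.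
  rewrite -(ler_pM2l (_ : 0 < N%:R)) ?ltr0n // -phase_locked_sum_cos.
  rewrite -[X in X%:R]card_ord mulr_natl -sumr_const.
  by apply: ler_sum.
by move=> j; rewrite -s2 expr2 ler_pM ?sqrtr_ge0.
Qed.

End PhaseLocked.

(** * Bounds at the critical coupling *)

Section CriticalState.
Variables (R : realType) (N : nat) (Omega alpha : 'I_N -> R).
Variables (kappa lambda : R).
Hypothesis critical : critical_state Omega kappa lambda alpha.
Hypothesis N_gt0 : (0 < N)%N.

Let locked : phase_locked Omega kappa lambda alpha.
Proof. by case: critical. Qed.

Lemma critical_sum_inv_cos :
  \sum_(l < N) (cos (alpha l))^-1 = 2 * N%:R * lambda.
Proof.
case: critical => _ lE; rewrite [in RHS]lE mulVKf // mulf_neq0 ?pnatr_eq0 //.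
by rewrite -lt0n.
Qed.

(* Tangent line form of the inequality between arithmetic and harmonic means:
   [1 / c >= 2 / lambda - c / lambda ^ 2]. *)
Lemma critical_lambda_ge : 1 / 2 <= lambda ^+ 2.
Proof.
have l0 := phase_locked_lambda_gt0 locked N_gt0.
have cos0 := phase_locked_cos_gt0 locked.
have N0 : (0 : R) < N%:R by rewrite ltr0n.
have : \sum_(l < N) (2 * lambda - cos (alpha l)) <=
    \sum_(l < N) (cos (alpha l))^-1 * lambda ^+ 2.
  apply: ler_sum => l _; rewrite -(ler_pM2l (cos0 l)) mulrA divff ?gt_eqF //.
  by have := sqr_ge0 (lambda - cos (alpha l)); nra.
rewrite sumrB sumr_const card_ord -mulr_suml critical_sum_inv_cos.
rewrite (phase_locked_sum_cos locked N_gt0) -[_ *+ N]mulr_natl => h.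
have : N%:R * lambda * 1 <= N%:R * lambda * (2 * lambda ^+ 2) by lra.
by rewrite ler_pM2l ?mulr_gt0 //; lra.
Qed.

(** Otherwise [cos^2 > 1/2], that is [1 / cos < 2 cos], for all phases; summing contradicts the
    critical equation. *)
Lemma critical_sin_ge : exists j, 1 / 2 <= sin (alpha j) ^+ 2.
Proof.
apply: contrapT => nex.
have cos0 := phase_locked_cos_gt0 locked.
have : \sum_(l < N) (cos (alpha l))^-1 < \sum_(l < N) 2 * cos (alpha l).
  apply: ltr_sum => [|l _].
    by apply/hasP; exists (Ordinal N_gt0); rewrite ?mem_index_enum.
  rewrite -(ltr_pM2l (cos0 l)) divff ?gt_eqF //.
  have := cos2Dsin2 (alpha l); have : sin (alpha l) ^+ 2 < 1 / 2.
    by rewrite ltNge; apply/negP => h; apply: nex; exists l.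
  lra.
rewrite -mulr_sumr critical_sum_inv_cos.
by rewrite (phase_locked_sum_cos locked N_gt0) mulrA ltxx.
Qed.

(** In [Omega j = lambda kappa sin alpha_j], both [lambda] and, for some [j], [|sin alpha_j|] are at
    least [1 / sqrt 2], so [kappa / 2 <= M]. The proof compares squares. *)
Lemma critical_coupling_le (M : R) :
  0 < kappa -> (forall j, `|Omega j| <= M) -> kappa <= 2 * M.
Proof.
move=> kappa0 OmegaM.
have l0 := phase_locked_lambda_gt0 locked N_gt0.
have l2 := critical_lambda_ge.
have [j] := critical_sin_ge; rewrite (phase_locked_sin locked) => sj.
have M0 : 0 <= M := le_trans (normr_ge0 _) (OmegaM j).
rewrite -ler_sqr ?nnegrE ?mulr_ge0 ?(ltW kappa0) // exprMn.
have : Omega j ^+ 2 <= M ^+ 2.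
  by rewrite -real_normK ?num_real // ler_sqr ?nnegrE.
move: sj; rewrite expr_div_n ler_pdivlMr ?exprn_gt0 ?mulr_gt0 // exprMn.
have : 0 < kappa ^+ 2 by rewrite exprn_gt0.
nra.
Qed.

End CriticalState.

(** * Stability along the branch *)

Lemma stable_branch_linearly_stable (R : realType) (N : nat)
    (Omega : 'I_N -> R) (kstar : R) (lambda : R -> R) (alpha : R -> 'I_N -> R)
    (M kappa : R) :
  (0 < N)%N -> \sum_(j < N) Omega j = 0 ->
  stable_branch Omega kstar lambda alpha ->
  (forall j, `|Omega j| <= M) -> 2 * Num.sqrt 2 * M <= kappa ->
  kstar <= kappa /\ linearly_stable Omega kappa (phase_point (alpha kappa)).
Proof.
move=> N0 Omega0 [[kstar0 crit] locked lambda_incr _ _] OmegaM.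
have r2 : Num.sqrt 2 ^+ 2 = 2 :> R by rewrite sqr_sqrtr.
have r0 : 0 <= Num.sqrt 2 :> R by rewrite sqrtr_ge0.
move: (Num.sqrt 2) r2 r0 => r r2 r0 Mkappa.
have M0 : 0 <= M := le_trans (normr_ge0 _) (OmegaM (Ordinal N0)).
have kstarM := critical_coupling_le crit N0 kstar0 OmegaM.
have r1 : 1 <= r by nra.
have kle : kstar <= kappa by nra.
split=> //.
have kappa0 : 0 < kappa := lt_le_trans kstar0 kle.
have lockedk := locked _ kle.
apply: (phase_locked_linearly_stable lockedk) => // j.
have l0 := phase_locked_lambda_gt0 lockedk N0.
(* The critical bound is carried to [kappa] by monotonicity of [lambda]. *)
have l2 : 1 / 2 <= lambda kappa ^+ 2.
  apply: le_trans (critical_lambda_ge crit N0) _.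
  rewrite ler_sqr ?nnegrE ?(ltW l0) //; last first.
    exact: ltW (phase_locked_lambda_gt0 (proj1 crit) N0).
  by move: kle; rewrite le_eqVlt => /predU1P[->//|/lambda_incr/ltW ->].
have := cos2Dsin2 (alpha kappa j).
(* Here [lambda^2 >= 1/2] and [kappa^2 >= 8 M^2] give [(lambda kappa)^2 >= 4 M^2], whence the factor
   [2 sqrt 2] in the threshold. *)
suff : sin (alpha kappa j) ^+ 2 <= 1 / 4 by lra.
rewrite (phase_locked_sin lockedk) expr_div_n.
rewrite ler_pdivrMr ?exprn_gt0 ?mulr_gt0 //.
have O2 : Omega j ^+ 2 <= M ^+ 2.
  by rewrite -real_normK ?num_real // ler_sqr ?nnegrE.
have k2 : 8 * M ^+ 2 <= kappa ^+ 2.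
  have : (2 * r * M) ^+ 2 <= kappa ^+ 2.
    by rewrite ler_sqr ?nnegrE ?mulr_ge0 // ltW.
  by rewrite !exprMn r2; lra.
rewrite exprMn; have : 0 < kappa ^+ 2 by rewrite exprn_gt0.
nra.
Qed.

Theorem theorem7p2 (R : realType) (N : nat) (hN : (2 <= N)%N)
    (Omega : 'I_N -> R) (Omega_neq0 : exists j, Omega j != 0)
    (Omega_sum : \sum_(j < N) Omega j = 0)
    (kstar : R) (lambda : R -> R) (alpha : R -> 'I_N -> R)
    (hbranch : stable_branch Omega kstar lambda alpha) :
  (exists2 eps0 : R, 0 < eps0 &
     forall eps : R, 0 < eps -> eps < eps0 ->
       kstar < eps^-1 /\
       linearly_stable Omega eps^-1 (phase_point (alpha eps^-1)))
  /\
  ((forall j1 k1 j2 k2 : 'I_N, j1 != k1 -> j2 != k2 -> (j1, k1) != (j2, k2) ->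
      Omega j1 - Omega k1 != Omega j2 - Omega k2) ->
   forall kappa : R,
     2 * Num.sqrt 2 * \big[Num.max/0]_(j < N) `|Omega j| <= kappa ->
     kstar <= kappa /\
     linearly_stable Omega kappa (phase_point (alpha kappa))).
Proof.
have N0 : (0 < N)%N := ltnW hN.
set M := \big[Num.max/0]_(j < N) `|Omega j|.
have OmegaM j : `|Omega j| <= M by exact: le_bigmax.
have stable kappa :=
  stable_branch_linearly_stable (kappa := kappa) N0 Omega_sum hbranch OmegaM.
split=> [|_ kappa]; last exact: stable.
pose K := 2 * Num.sqrt 2 * M.
(* Applied at the threshold itself, the bound gives [0 < kstar <= K], so [1 / K] can serve as
   [eps0]. *)
have [kstarK _] := stable K (lexx _).
have kstar0 : 0 < kstar by case: hbranch => -[].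
have K0 : 0 < K := lt_le_trans kstar0 kstarK.
exists K^-1 => [|eps eps0 epsK]; first by rewrite invr_gt0.
have Keps : K < eps^-1 by rewrite -[K]invrK ltf_pV2 // posrE invr_gt0.
split; first exact: le_lt_trans Keps.
by have [] := stable _ (ltW Keps).
Qed.
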